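(* Let $p$ be a prime number and let $G_*$ be an $N$-series on a group $G$. Then $\mathcal A_j(G_* )\subseteq\mathcal A_j(G_*^{[p]})$ for all $j\ge0$.
   Context: A filtration $G_*$ on a group $G$ is a sequence of subgroups $G=G_1\supseteq G_2\supseteq\cdots$; it is an $N$-series if $[G_i,G_j]\subseteq G_{i+j}$ for all $i,j\ge1$, and an $N_p$-series if moreover $g^p\in G_{pi}$ for all $i\ge1$ and $g\in G_i$. For an $N$-series $G_*$, $G_*^{[p]}$ is the smallest $N_p$-series on $G$ containing $G_*$ termwise (it exists). For a filtration $G_*$ by normal subgroups, $\mathcal A_0(G_* )$ is the group of automorphisms $\varphi$ of $G$ such that $\varphi(G_i)\subseteq G_i$ and $\varphi^{-1}(G_i)\subseteq G_i$ for all $i$; for $j\ge1$, $\mathcal A_j(G_* )$ is the subgroup of those $\varphi\in\mathcal A_0(G_* )$ such that $\varphi(g)g^{-1}\in G_{i+j}$ for all $i\ge1$ and $g\in G_i$. *)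

(* Defs.v *)
From mathcomp Require Import all_boot all_fingroup.
From mathcomp Require Import boolp classical_sets.
Set Implicit Arguments.
Unset Strict Implicit.
Unset Printing Implicit Defensive.
Local Open Scope classical_set_scope.
Local Open Scope group_scope.

(* A sequence of subsets G_1, G_2, ... is a function from nat to sets whose
   value at 0 is irrelevant: all conditions below are restricted to positive
   indices. *)

Definition subgroup (G : groupType) : set (set G) :=
  [set H | group_closed (mem H)].

Definition commutator_subgroup (G : groupType) (H K : set G) : set G :=
  smallest (@subgroup G) [set [~ x, y] | x in H & y in K].

Definition filtration (G : groupType) (F : nat -> set G) : Prop :=
  [/\ forall i, 1 <= i -> subgroup (F i),
      F 1%N = setT &
      forall i, 1 <= i -> F i.+1 `<=` F i].

Definition N_series (G : groupType) (F : nat -> set G) : Prop :=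
  filtration F /\
  forall i j, 1 <= i -> 1 <= j ->
    commutator_subgroup (F i) (F j) `<=` F (i + j)%N.

Definition Np_series (p : nat) (G : groupType) (F : nat -> set G) : Prop :=
  N_series F /\ forall i g, 1 <= i -> F i g -> F (p * i)%N (g ^+ p).

Definition contains_termwise (G : groupType) (F E : nat -> set G) : Prop :=
  forall i, 1 <= i -> E i `<=` F i.

(* The smallest N_p-series containing E termwise, as the termwise intersection
   of all of them; see Np_hull_series, Np_hull_contains and Np_hull_least. *)
Definition Np_hull (p : nat) (G : groupType) (E : nat -> set G) : nat -> set G :=
  fun i => \bigcap_(F in [set F | Np_series p F /\ contains_termwise F E]) F i.

Definition filtration_aut0 (G : groupType) (F : nat -> set G) :
    set {multiplicative G -> G} :=
  [set phi | bijective phi /\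
     forall i, 1 <= i -> phi @` F i `<=` F i /\ phi @^-1` F i `<=` F i].

Definition filtration_aut (G : groupType) (F : nat -> set G) (j : nat) :
    set {multiplicative G -> G} :=
  if j is 0 then filtration_aut0 F
  else [set phi | filtration_aut0 F phi /\
          forall i g, 1 <= i -> F i g -> F (i + j)%N (phi g * g^-1)].

Lemma Np_hull_contains (p : nat) (G : groupType) (E : nat -> set G) :
  contains_termwise (Np_hull p E) E.
Proof. by move=> i i1 x Ex F [_ FE]; exact: FE. Qed.

Lemma Np_hull_least (p : nat) (G : groupType) (E F : nat -> set G) :
  Np_series p F -> contains_termwise F E -> contains_termwise F (Np_hull p E).
Proof. by move=> NF FE i _ x; apply. Qed.

Lemma subgroup_bigcap (G : groupType) (I : Type) (D : set I) (H : I -> set G) :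
  (forall i, D i -> subgroup (H i)) -> subgroup (\bigcap_(i in D) H i).
Proof.
move=> sH; split=> [|x y /set_mem Hx /set_mem Hy]; apply/mem_set=> i Di;
  have [H1 HV] := sH i Di; first exact: set_mem H1.
by apply/set_mem/HV; apply/mem_set; [exact: Hx | exact: Hy].
Qed.

Lemma Np_hull_series (p : nat) (G : groupType) (E : nat -> set G) :
  0 < p -> E 1%N = setT -> Np_series p (Np_hull p E).
Proof.
move=> p0 E1; split; [split; [split|]|].
- by move=> i i1; apply: subgroup_bigcap => F [[[[sF _ _] _] _] _]; exact: sF.
- rewrite -subTset -E1; exact: Np_hull_contains.
- move=> i i1 x Hx F DF; have [[[[_ _ dF] _] _] _] := DF.
  by apply: dF => //; exact: Hx.
- move=> i j i1 j1 x Hx F DF; have [[[[sF _ _] cF] _] _] := DF.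
  apply: (cF i j) => // K [sK KF]; apply: Hx; split=> // _ [a Ha [b Hb <-]].
  by apply: KF; exists a; [exact: Ha | exists b => //; exact: Hb].
- move=> i g i1 Hg F DF; have [[_ pF] _] := DF.
  by apply: pF => //; exact: Hg.
Qed.

(* Main.v *)
Require Import Defs.
From HB Require Import structures.
From mathcomp Require Import all_boot all_fingroup.
From mathcomp Require Import boolp classical_sets.

(** Write [C] for the smallest N_p-series containing [Gs]. No explicit
    description of [C] is used: its minimality turns each claim about all of
    [C] into the construction of an N_p-series that contains [Gs].

    For [j = 0], the preimage of [C] under an endomorphism preserving [Gs] is
    such a series; this applies to [phi] and to its inverse.

    For [j > 0], take the terms [E m] formed by the [x] in [C m] with
    [x^-1 * phi x] in [C (m + j)] (on the normal subgroup [C (m + j)] this is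
    the same as [phi x * x^-1]). They contain [Gs] because [phi] lies in the
    j-th group of [Gs], and they form an N-series ([diff_series_N0]) by an
    identity for commutators of perturbed elements ([commg_diff]). It remains
    to see that [E] absorbs p-th powers: with [phi x = a * x], this says that
    [(a * x) ^+ p * x ^- p] lies in [C (p * i + j)] whenever [x] is in [C i]
    and [a] in [C (i + j)] ([expg_mul_prime]), a consequence of the
    Hall-Petrescu formula.

    The latter is proved with Lazard's polynomial sequences. In the group of
    all sequences in [G], let the sequences of degree [m] be those whose k-th
    iterated difference, for [g n ^-1 * g n.+1] as first difference, takes
    values in [C (m + k * i)], for all [k].
    Differences along the shift endomorphism are an instance of the same
    construction [diff_series], so these sequences form an N-series again. The
    sequence [(a * x) ^+ n * x ^- n] has degree [j], since its difference is a
    conjugate of the constant [a]. Expanding it as a product of factors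
    [c_r ^+ 'C(n, r)] with [c_r] in [C (j + r * i)] and evaluating at [n = p]
    gives the result: [p] divides ['C(p, r)] for [0 < r < p], and the factor
    [c_p] already lies deep enough ([poly_seq_prime]). *)

Set Implicit Arguments.
Unset Strict Implicit.
Unset Printing Implicit Defensive.

Local Open Scope classical_set_scope.
Local Open Scope group_scope.

(** * N-series indexed from 0, and differences along an endomorphism *)

(** Degree 0 is needed for elements that act on the series while lying at no
    positive depth. The commutator condition with [n = 0] says that each term
    is normalized by the term of index 0. *)
Record N0_series (H : groupType) (F : nat -> set H) : Prop := N0Series {
  N0_1 : forall m, F m 1;
  N0_M : forall m x y, F m x -> F m y -> F m (x * y);
  N0_V : forall m x, F m x -> F m x^-1;
  N0_anti : forall m n x, (m <= n)%N -> F n x -> F m x;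
  N0_R : forall m n x y, F m x -> F n y -> F (m + n)%N [~ x, y] }.

Lemma N0_J (H : groupType) (F : nat -> set H) (hF : N0_series F) m n x y :
  F m x -> F n y -> F m (x ^ y).
Proof.
move=> Fx Fy; have -> : x ^ y = x * [~ x, y] by rewrite commgEl mulVKg.
by apply: (N0_M hF) => //; apply: (N0_anti hF (leq_addr n m)); apply: N0_R.
Qed.

Lemma N0_X (H : groupType) (F : nat -> set H) (hF : N0_series F) m x e :
  F m x -> F m (x ^+ e).
Proof.
move=> Fx; elim: e => [|e IHe]; first exact: N0_1 hF m.
by rewrite expgS; apply: N0_M.
Qed.

(** Replacing [x] by [x * u] and [y] by [y * v] changes their commutator only
    by conjugates of commutators having [u], [v] or [v * u] as an entry; if [u]
    and [v] lie [s] steps deeper than [x] and [y], these lie [s] steps deeper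
    than [[~ x, y]]. *)
Lemma commg_diff (H : groupType) (x y u v : H) :
  [~ x, y]^-1 * [~ x * u, y * v] =
    [~ x, v] ^ (u * [~ x, y]) * [~ [~ x, y], v * u] * [~ u, y * v].
Proof.
by rewrite !commgEl !conjgE !invgM !invgK !mulgA !(mulgK, mulgVK, mulgV, mulVg, mul1g).
Qed.

Section MorphismOfGroups.
Context (H : groupType) (f : H -> H) (fM : {morph f : x y / x * y}).

Lemma morph1g : f 1 = 1.
Proof. by apply: (mulgI (f 1)); rewrite -fM !mulg1. Qed.

Lemma morphVg : {morph f : x / x^-1}.
Proof. by move=> x; apply: (mulgI (f x)); rewrite -fM !mulgV morph1g. Qed.

Lemma morphXg e : {morph f : x / x ^+ e}.
Proof.
move=> x; elim: e => [|e IHe]; first by rewrite !expg0 morph1g.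
by rewrite !expgS fM IHe.
Qed.

Lemma morphRg : {morph f : x y / [~ x, y]}.
Proof. by move=> x y; rewrite !commgEl !conjgE !(fM, morphVg). Qed.

End MorphismOfGroups.

(** The elements of each term that [f] moves by [s] further steps. It serves
    twice: for an automorphism of [G], and for the shift on sequences. *)
Definition diff_series (H : groupType) (f : H -> H) (s : nat)
    (F : nat -> set H) : nat -> set H :=
  fun m => [set x | F m x /\ F (m + s)%N (x^-1 * f x)].

Lemma diff_series_N0 (H : groupType) (f : H -> H) (s : nat)
    (F : nat -> set H) :
  {morph f : x y / x * y} -> N0_series F -> N0_series (diff_series f s F).
Proof.
move=> fM hF.
have fE x : f x = x * (x^-1 * f x) by rewrite mulVKg.
split.
- by move=> m; split; rewrite ?(morph1g fM) ?mulVg; apply: N0_1.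
- move=> m x y [Fx Fu] [Fy Fv]; split; first exact: N0_M.
  have -> : (x * y)^-1 * f (x * y) = (x^-1 * f x) ^ y * (y^-1 * f y).
    by rewrite fM invgM conjgE !mulgA mulgK.
  by apply: (N0_M hF) => //; apply: N0_J Fu Fy.
- move=> m x [Fx Fu]; split; first exact: N0_V.
  have -> : x^-1^-1 * f x^-1 = (x^-1 * f x)^-1 ^ x^-1.
    by rewrite (morphVg fM) conjgE !invgM !invgK !mulgA mulgK.
  by apply: (N0_J hF) (N0_V hF Fx); apply: N0_V.
- move=> m n x mn [Fx Fu]; split; first exact: N0_anti mn Fx.
  by apply: N0_anti Fu => //; rewrite leq_add2r.
- move=> m n x y [Fx Fu] [Fy Fv]; split; first exact: N0_R.
  have Fxy := N0_R hF Fx Fy.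
  rewrite (morphRg fM) (fE x) (fE y) commg_diff.
  set u := x^-1 * f x; set v := y^-1 * f y.
  have F0 k z : F k z -> F 0%N z by apply: (N0_anti hF).
  apply: (N0_M hF); first apply: (N0_M hF).
  + apply: (N0_J hF (n := 0)); first by rewrite -addnA; apply: N0_R.
    by apply: (N0_M hF); [apply: F0 Fu | apply: F0 Fxy].
  + apply: (N0_R hF) => //.
    apply: (N0_M hF); apply: (N0_anti hF (leq_addl _ s)); [exact: Fv | exact: Fu].
  + rewrite addnAC; apply: (N0_R hF) => //.
    by apply: (N0_M hF) => //; apply: (N0_anti hF (leq_addr s n)).
Qed.

(** * Polynomial sequences *)

(** An alias of [nat -> G] that carries the pointwise group structure. *)
Definition gseq (G : groupType) : Type := nat -> G.
HB.instance Definition _ (G : groupType) := Choice.on (gseq G).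

Fact gseq_mulgA (G : groupType) :
  associative (fun (g h : gseq G) n => g n * h n).
Proof. by move=> g h k; apply/funext => n; rewrite mulgA. Qed.
Fact gseq_mul1g (G : groupType) :
  left_id (fun=> 1) (fun (g h : gseq G) n => g n * h n).
Proof. by move=> g; apply/funext => n; rewrite mul1g. Qed.
Fact gseq_mulg1 (G : groupType) :
  right_id (fun=> 1) (fun (g h : gseq G) n => g n * h n).
Proof. by move=> g; apply/funext => n; rewrite mulg1. Qed.
Fact gseq_mulVg (G : groupType) :
  left_inverse (fun=> 1) (fun (g : gseq G) n => (g n)^-1)
    (fun (g h : gseq G) n => g n * h n).
Proof. by move=> g; apply/funext => n; rewrite mulVg. Qed.
Fact gseq_mulgV (G : groupType) :
  right_inverse (fun=> 1) (fun (g : gseq G) n => (g n)^-1)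
    (fun (g h : gseq G) n => g n * h n).
Proof. by move=> g; apply/funext => n; rewrite mulgV. Qed.
HB.instance Definition _ (G : groupType) := isGroup.Build (gseq G)
  (@gseq_mulgA G) (@gseq_mul1g G) (@gseq_mulg1 G)
  (@gseq_mulVg G) (@gseq_mulgV G).

Lemma gseqM (G : groupType) (g h : gseq G) n : (g * h) n = g n * h n.
Proof. by []. Qed.

Lemma gseqV (G : groupType) (g : gseq G) n : g^-1 n = (g n)^-1.
Proof. by []. Qed.

Definition gseqE := (gseqM, gseqV).

Definition shift (G : groupType) (g : gseq G) : gseq G := fun n => g n.+1.

(** In index [m]: the sequences whose r-th iterated difference takes values in
    [F (m + r * i)], for all [r <= k]. *)
Definition poly_seq (G : groupType) (F : nat -> set G) (i k : nat) :
    nat -> set (gseq G) :=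
  iter k (diff_series (@shift G) i) (fun m => [set g | forall n, F m (g n)]).

Section PolynomialSequences.
Context (G : groupType) (F : nat -> set G) (hF : N0_series F) (i : nat).
Implicit Types (g h : gseq G) (c : G) (k m n r : nat).

Lemma poly_seq_N0 k : N0_series (poly_seq F i k).
Proof.
elim: k => [|k IHk]; last exact: diff_series_N0.
split.
- by move=> m n; apply: N0_1.
- by move=> m g h Fg Fh n; apply: (N0_M hF).
- by move=> m g Fg n; apply: (N0_V hF).
- by move=> m e g me Fg n; apply: N0_anti me (Fg n).
- by move=> m e g h Fg Fh n; apply: (N0_R hF).
Qed.

Lemma poly_seq_val k m g : poly_seq F i k m g -> forall n, F m (g n).
Proof. by elim: k => //= k IHk [/IHk]. Qed.

(** By Pascal's rule, taking the difference lowers [r] by 1. *)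
Lemma poly_seq_bin k m r c :
  F (m + r * i)%N c -> poly_seq F i k m (fun n => c ^+ 'C(n, r)).
Proof.
elim: k m r => [|k IHk] m r Fc.
  by move=> n; apply: N0_X => //; apply: (N0_anti hF (leq_addr _ _) Fc).
split; first exact: IHk.
case: r Fc => [|r] Fc.
  rewrite (_ : _ * _ = 1); first exact: N0_1 (poly_seq_N0 k) _.
  by apply/funext => n; rewrite !gseqE /shift !bin0 mulVg.
rewrite (_ : _ * _ = (fun n => c ^+ 'C(n, r)) :> gseq G).
  by apply: IHk; rewrite -addnA.
by apply/funext => n; rewrite !gseqE /shift binS expgnDr mulKg.
Qed.

(** When all earlier values are trivial, [g r] is the r-th difference of [g]
    at 0. *)
Lemma poly_seq_lead k m g r : poly_seq F i k m g -> (r <= k)%N ->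
  (forall n, (n < r)%N -> g n = 1) -> F (m + r * i)%N (g r).
Proof.
elim: r k m g => [|r IHr] k m g Pg.
  by move=> _ _; rewrite addn0; apply: poly_seq_val Pg 0.
case: k Pg => // k [_ Pg] rk g1.
have D n : (n < r.+1)%N -> (g^-1 * shift g) n = g n.+1.
  by move=> nr; rewrite !gseqE /shift g1 // invg1 mul1g.
rewrite -D // mulSn addnA; apply: IHr Pg rk _ => n nr.
by rewrite D ?g1 // ltnW.
Qed.

(** The expansion of [g] into factors [c ^+ 'C(n, r)] is peeled off one [r] at
    a time: each step makes one more value trivial, and the removed factor is
    a p-th power at [n = p] as long as [r < p]. *)
Lemma poly_seq_prime p m g : prime p ->
    (forall e x, F e x -> F (p * e)%N (x ^+ p)) ->
    poly_seq F i p m g -> g 0%N = 1 ->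
  F (m + p * i)%N (g p).
Proof.
move=> pr_p Fp Pg g0.
suff vanish d r h : (r + d)%N = p -> (0 < r)%N -> poly_seq F i p m h ->
    (forall n, (n < r)%N -> h n = 1) -> F (m + p * i)%N (h p).
  apply: (vanish p.-1 1%N g) => //; first by rewrite add1n prednK // prime_gt0.
  by case.
elim: d r h => [|d IHd] r h rd r0 Ph h1.
  by move: rd h1; rewrite addn0 => -> h1; apply: poly_seq_lead Ph _ h1.
have rp : (r < p)%N by rewrite -rd addnS ltnS leq_addr.
(* [h r] is the coefficient attached to ['C(n, r)] in the expansion of [h]. *)
have Fc : F (m + r * i)%N (h r) by apply: poly_seq_lead Ph (ltnW rp) h1.
pose b : gseq G := fun n => h r ^+ 'C(n, r).
have Pb : poly_seq F i p m b by apply: poly_seq_bin.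
have -> : h p = (h * b^-1) p * b p by rewrite [RHS]mulgVK.
apply: (N0_M hF).
  apply: (IHd r.+1) => //; first by rewrite addSnnS.
    by apply: (N0_M (poly_seq_N0 p)) => //; apply: N0_V => //; apply: poly_seq_N0.
  move=> n; rewrite ltnS leq_eqVlt /mul /inv /= /b => /orP[/eqP->|nr].
    by rewrite binn mulgV.
  by rewrite h1 // bin_small // invg1 mulg1.
rewrite /b; have /dvdnP[q ->] : p %| 'C(p, r) by apply: prime_dvd_bin; rewrite ?r0.
rewrite expgnA; apply: (N0_anti hF) (Fp _ _ (N0_X hF q Fc)).
rewrite mulnDr leq_add ?leq_pmull ?prime_gt0 //.
by rewrite leq_mul2l leq_pmull ?orbT.
Qed.

(** An element [a] that lies [s] steps deeper than [x] does not alter [x ^+ p]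
    modulo the term [s] steps beyond that of [x ^+ p]. *)
Lemma expg_mul_prime p s a x : prime p ->
    (forall e y, F e y -> F (p * e)%N (y ^+ p)) -> F 0%N = setT ->
    F i x -> F (s + i)%N a ->
  F (s + p * i)%N ((a * x) ^+ p * x ^- p).
Proof.
move=> pr_p Fp F0 Fx Fa.
pose X : gseq G := fun n => x ^+ 'C(n, 1).
pose g : gseq G := fun n => (a * x) ^+ n * x ^- n.
have PX k : poly_seq F i k 0 X by apply: poly_seq_bin; rewrite add0n mul1n.
have Pa k : poly_seq F i k (s + i) (fun=> a).
  have := @poly_seq_bin k (s + i) 0 a; rewrite addn0 => /(_ Fa).
  by congr (poly_seq F i k _ _); apply/funext => n; rewrite bin0.
have Dg : g^-1 * shift g = ((fun=> a) : gseq G) ^ X^-1.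
  apply/funext => n; rewrite conjgE !gseqE /shift /g /X bin1.
  by rewrite !expgSr !invgM !invgK !mulgA mulgVK mulgK.
suff Pg k : poly_seq F i k s g.
  by apply: (poly_seq_prime pr_p Fp (Pg p)); rewrite /g mulgV.
elim: k => [|k IHk] /=; last first.
  split=> //; rewrite Dg; apply: (N0_J (poly_seq_N0 k) (n := 0)) => //.
  by apply: (N0_V (poly_seq_N0 k)).
(* For the values, [g] is recovered from its difference by [g 0 = 1] and
   [g n.+1 = g n * (difference at n)]. *)
elim=> [|n IHn]; first by rewrite /g mulgV; apply: N0_1.
have -> : g n.+1 = g n * (g^-1 * shift g) n by rewrite [RHS]mulVKg.
apply: (N0_M hF) => //; rewrite Dg.
apply: (N0_J hF (n := 0)); last by rewrite F0.
exact: N0_anti (leq_addr _ _) Fa.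
Qed.

End PolynomialSequences.

(** * Application to the smallest N_p-series *)

(** The value of a series at 0 is arbitrary, and is reset here to [G], the only
    choice that makes every element of [G] act. *)
Definition extend0 (G : groupType) (F : nat -> set G) : nat -> set G :=
  fun m => if m is 0 then setT else F m.

Lemma N0_extend0 {G : groupType} {F : nat -> set G} :
  N_series F -> N0_series (extend0 F).
Proof.
move=> [[sF F1 dF] cF].
have F_1 m : (0 < m)%N -> F m 1 by move=> /sF[/set_mem].
have FV m x : (0 < m)%N -> F m x -> F m x^-1.
  by move=> /sF /group_closedV FV Fx; apply/set_mem/FV/mem_set.
have FM m x y : (0 < m)%N -> F m x -> F m y -> F m (x * y).
  by move=> /sF /group_closedM FM Fx Fy; apply/set_mem/FM; apply/mem_set.
have FR m n x y : (0 < m)%N -> (0 < n)%N -> F m x -> F n y -> F (m + n)%N [~ x, y].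
  by move=> m0 n0 Fx Fy; apply: cF => // K [_]; apply; exists x => //; exists y.
have FJ m x y : (0 < m)%N -> F m x -> F m [~ x, y].
  by move=> m0 Fx; apply: dF => //; rewrite -addn1; apply: FR; rewrite ?F1.
have anti m n x : (0 < m)%N -> (m <= n)%N -> F n x -> F m x.
  move=> m0 /subnK<-; elim: (n - m)%N => // d IHd.
  by rewrite addSn => /(dF _ (leq_trans m0 (leq_addl d m))).
split=> [[|m]|[|m]|[|m]|[|m] [|n]|[|m] [|n]] //=.
- exact: F_1.
- by move=> *; apply: FM.
- by move=> *; apply: FV.
- by move=> x; apply: anti.
- by move=> x y _ Fy; rewrite -invgR; apply: FV => //; apply: FJ.
- by move=> x y Fx _; rewrite addn0; apply: FJ.
- by move=> *; apply: FR.
Qed.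

(** Only the values of [E] at positive indices are compared, and [E 1] is the whole group as soon as
    [E] contains [Gs]. *)
Lemma Np_hull_le_N0 (p : nat) (G : groupType) (Gs E : nat -> set G) :
    N0_series E -> Gs 1%N = setT -> contains_termwise E Gs ->
    (forall m x, E m x -> E (p * m)%N (x ^+ p)) ->
  contains_termwise E (Np_hull p Gs).
Proof.
move=> hE G1 GsE Ep; apply: Np_hull_least => //.
have sE m : subgroup (E m).
  split=> [|x y /set_mem Ex /set_mem Ey]; apply/mem_set; first exact: N0_1.
  by apply: (N0_M hE) => //; apply: N0_V.
split=> [|m x _]; last exact: Ep.
split=> [|m n _ _ z]; last by apply; split=> // _ [x Ex [y Ey <-]]; apply: N0_R.
split=> //; last by move=> m _ x; apply: N0_anti.
by rewrite -subTset -G1; apply: GsE.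
Qed.

Lemma extend0_expg {p : nat} {G : groupType} {F : nat -> set G} :
  (0 < p)%N -> Np_series p F ->
  forall m x, extend0 F m x -> extend0 F (p * m)%N (x ^+ p).
Proof.
move=> p0 [_ Fp] [|m] x Fx; first by rewrite muln0.
by case E: (p * m.+1)%N => [|e] //=; rewrite -E; apply: Fp.
Qed.

(** The preimage under [f] of the smallest N_p-series is an N_p-series, and it
    contains [Gs]. *)
Lemma Np_hull_morph (p : nat) (G : groupType) (Gs : nat -> set G) (f : G -> G) :
    (0 < p)%N -> Gs 1%N = setT -> {morph f : x y / x * y} ->
    (forall m x, (0 < m)%N -> Gs m x -> Gs m (f x)) ->
  forall m x, (0 < m)%N -> Np_hull p Gs m x -> Np_hull p Gs m (f x).
Proof.
move=> p0 G1 fM fGs m x m0.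
have NpC := Np_hull_series p0 G1.
have hC := N0_extend0 NpC.1.
pose E n := [set z | extend0 (Np_hull p Gs) n (f z)].
suff : contains_termwise E (Np_hull p Gs).
  by move=> /(_ m m0 x); rewrite /E; case: m m0.
apply: Np_hull_le_N0 => //.
- split; rewrite /E /=.
  + by move=> n; rewrite (morph1g fM); apply: N0_1.
  + by move=> n y z; rewrite fM; apply: N0_M.
  + by move=> n y; rewrite (morphVg fM); apply: N0_V.
  + by move=> n e y; apply: N0_anti.
  + by move=> n e y z; rewrite (morphRg fM); apply: N0_R.
- by case=> // n _ z Gz; apply: Np_hull_contains => //; apply: fGs.
- by move=> n z; rewrite /E /= (morphXg fM); apply: extend0_expg.
Qed.

Unset Implicit Arguments.

Theorem proposition6p8 (p : nat) (hp : prime p) (G : groupType)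
    (Gs : nat -> set G) (hG : N_series Gs) :
  forall j : nat, filtration_aut Gs j `<=` filtration_aut (Np_hull p Gs) j.
Proof.
have p0 := prime_gt0 hp.
have G1 : Gs 1%N = setT by have [[_ G1 _] _] := hG.
have NpC := Np_hull_series p0 G1.
have hC := N0_extend0 NpC.1.
have aut0 phi : filtration_aut0 Gs phi -> filtration_aut0 (Np_hull p Gs) phi.
  move=> [bij_phi Gphi]; split=> // i i0.
  have phiM : {morph phi : x y / x * y} by apply: gmulfM.
  split.
    move=> _ [x Cx <-]; apply: Np_hull_morph Cx => // m y m0 Gy.
    by apply: (Gphi m m0).1; exists y.
  case: bij_phi => psi phiK psiK x /= Cx; rewrite -(phiK x).
  have psiM : {morph psi : y z / y * z} by apply: can2_gmulfM phiK psiK.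
  apply: Np_hull_morph Cx => // m y m0 Gy.
  by apply: (Gphi m m0).2; rewrite /preimage /= psiK.
case=> [|j] phi; first exact: aut0.
move=> [phi0 phij]; split=> [|i g i0 Cg]; first exact: aut0.
have phiM : {morph phi : x y / x * y} by apply: gmulfM.
set s := j.+1 in phij *.
pose C0 := extend0 (Np_hull p Gs).
have C0s n e : (0 < e)%N -> C0 (n + e)%N = Np_hull p Gs (n + e)%N.
  by case: e => // e _; rewrite addnS.
(* [x^-1 * phi x] and [phi x * x^-1] are conjugate, and [C0 n] is normal. *)
have C0l n x : C0 n (x^-1 * phi x) <-> C0 n (phi x * x^-1).
  split=> C0x.
    have -> : phi x * x^-1 = (x^-1 * phi x) ^ x^-1.
      by rewrite conjgE invgK !mulgA mulgV mul1g.
    by apply: (N0_J hC (n := 0)).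
  have -> : x^-1 * phi x = (phi x * x^-1) ^ x by rewrite conjgE mulgVK.
  by apply: (N0_J hC (n := 0)).
suff : contains_termwise (diff_series phi s C0) (Np_hull p Gs).
  move=> /(_ i i0 g Cg) [_]; rewrite /C0; move/C0l.
  by rewrite C0s.
apply: Np_hull_le_N0 => //; first exact: diff_series_N0.
  case=> // n _ x Gx; split; first exact: Np_hull_contains.
  by apply/C0l; rewrite C0s //; apply: Np_hull_contains => //; apply: phij.
move=> m x [Cx /C0l Cphix]; split; first exact: extend0_expg.
apply/C0l.
have phiX : phi (x ^+ p) = (phi x * x^-1 * x) ^+ p by rewrite mulgVK (morphXg phiM).
rewrite phiX addnC; apply: (expg_mul_prime hC) => //.
  exact: extend0_expg.
by rewrite addnC.
Qed.
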